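(* Let $q$ be a proper element of $L$. Then the following statements are equivalent: (1) $q$ is $\phi$-$\delta$-primary. (2) For every $a\in L$ such that $a\not\leqslant \delta(q)$, either $(q:a)=q$ or $(q:a)=(\phi(q):a)$. (3) For all compact elements $r,s\in L$, $rs\leqslant q$ and $rs\not\leqslant \phi(q)$ implies either $s\leqslant q$ or $r\leqslant \delta(q)$.
   Context: A multiplicative lattice is a complete lattice (least element $0$, greatest element $1$) with a commutative, associative multiplication that distributes over arbitrary joins and for which $1$ is the identity. An element $a$ is compact if $a\leqslant \bigvee X$ with $X\subseteq L$ implies $a\leqslant a_1\vee\dots\vee a_n$ for finitely many $a_i\in X$; $L$ is compactly generated if every element is a join of compact elements. Standing assumptions: $L$ is a compactly generated multiplicative lattice in which $1$ is compact and every finite product of compact elements is compact; $\delta:L\to L$ is an expansion function, i.e. $a\leqslant\delta(a)$ for all $a$, and $a\leqslant b$ implies $\delta(a)\leqslant\delta(b)$; $\phi:L\to L$ is a function with $\phi(a)\leqslant a$ for all $a$. An element $p$ is proper if $p<1$. For $a,b\in L$, $(a:b)=\bigvee\{x\in L\mid xb\leqslant a\}$. A proper element $p\in L$ is $\phi$-$\delta$-primary if for all $a,b\in L$, $ab\leqslant p$ and $ab\not\leqslant\phi(p)$ implies either $a\leqslant p$ or $b\leqslant\delta(p)$. *)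

(* Defs.v *)
From HB Require Import structures.
From mathcomp Require Import all_boot all_order.
From mathcomp Require Import boolp classical_sets.

Set Implicit Arguments.
Unset Strict Implicit.
Unset Printing Implicit Defensive.

Import Order.Theory.
Local Open Scope classical_set_scope.
Local Open Scope order_scope.

Declare Scope mlattice_scope.
Delimit Scope mlattice_scope with ML.
Local Open Scope mlattice_scope.

(* Arbitrary meets exist as well, as joins of sets of lower bounds, so that a
   join operation on all subsets suffices for completeness. *)
HB.mixin Record isJoinComplete (d : Order.disp_t) L of Order.TBLattice d L := {
  bigjoin : set L -> L;
  bigjoinP : forall X : set L, supremums X (bigjoin X)
}.

#[short(type="completeLatticeType")]
HB.structure Definition CompleteLattice (d : Order.disp_t) :=
  { L of isJoinComplete d L & Order.TBLattice d L }.

HB.mixin Record isMultiplicative (d : Order.disp_t) L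
    of CompleteLattice d L := {
  lmul : L -> L -> L;
  lmulA : associative lmul;
  lmulC : commutative lmul;
  lmul1x : left_id \top lmul;
  lmul_bigjoin : forall (a : L) (X : set L),
    lmul a (bigjoin X) = bigjoin [set lmul a x | x in X]
}.

#[short(type="multLatticeType")]
HB.structure Definition MultLattice (d : Order.disp_t) :=
  { L of isMultiplicative d L & CompleteLattice d L }.

Notation "x * y" := (lmul x y) : mlattice_scope.

HB.instance Definition _ (d : Order.disp_t) (L : multLatticeType d) :=
  Monoid.isComLaw.Build L \top lmul lmulA lmulC lmul1x.

Notation "\prod_ ( i <- r ) F" := (\big[lmul / \top]_(i <- r) F)
  : mlattice_scope.

Section Notions.
Variables (d : Order.disp_t) (L : multLatticeType d).
Implicit Types (a b p x : L) (X : set L) (delta phi : L -> L).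

(* The finite subfamily [s] may be empty, so that [\bot] is compact. *)
Definition compact_elt a : Prop :=
  forall X, a <= bigjoin X ->
    exists s : seq L, (forall x, x \in s -> X x) /\ a <= \join_(x <- s) x.

Definition compactly_generated : Prop :=
  forall a, exists X, (forall x, X x -> compact_elt x) /\ a = bigjoin X.

Definition expansion delta : Prop :=
  (forall a, a <= delta a) /\ (forall a b, a <= b -> delta a <= delta b).

Definition proper_elt p : Prop := p < \top.

Definition residual a b : L := bigjoin [set x | x * b <= a].

Definition phi_delta_primary phi delta p : Prop :=
  proper_elt p /\
  forall a b, a * b <= p -> ~ (a * b <= phi p) -> a <= p \/ b <= delta p.

End Notions.

Arguments compactly_generated {d} L.

(* Main.v *)
Require Import Defs.
From mathcomp Require Import all_boot all_order.
From mathcomp Require Import boolp classical_sets.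

(** The residual is right adjoint to multiplication: [x * b <= a] if and only
    if [x <= residual a b]. Taking [x := residual q a] itself as a factor
    turns the elementwise condition of a primary element into the dichotomy
    on residuals, and conversely the dichotomy applies to any [s] with
    [r * s <= q], since such an [s] lies below [residual q r].

    The step from compact elements to all elements rests on compact
    generation. Given [a * b <= q], [~ a * b <= phi q] and
    [~ b <= delta q], there are compact [a' <= a] and [b' <= b] with
    [~ a' * b' <= phi q], and a compact [r <= b] with [~ r <= delta q]. For
    every compact [s <= a] the enlarged factors [s `|` a'] and [r `|` b'] are
    compact and inherit all three conditions, which forces [s <= q]. Hence
    [a], the join of the compact elements below it, is below [q]. *)

Import Order.Theory.
Local Open Scope order_scope.
Local Open Scope mlattice_scope.

Section MultLattice.
Set Implicit Arguments.
Unset Strict Implicit.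

Context {d : Order.disp_t} {L : multLatticeType d}.
Implicit Types (a b c p x : L) (X : set L).

Lemma le_bigjoin X x : X x -> x <= bigjoin X.
Proof. by case: (bigjoinP X) => ub _ /ub. Qed.

Lemma bigjoin_le X b : (forall x, X x -> x <= b) -> bigjoin X <= b.
Proof. by case: (bigjoinP X) => _; apply. Qed.

Lemma lmul_mono2l c a b : a <= b -> c * a <= c * b.
Proof.
move=> le_ab.
(* Distributivity is only given for joins, so [b] is written as [a `|` b]. *)
have -> : b = bigjoin [set x | x = a \/ x = b].
  apply/le_anti/andP; split; first by apply: le_bigjoin; right.
  by apply: bigjoin_le => x [->|->].
by rewrite lmul_bigjoin; apply: le_bigjoin; exists a => //; left.
Qed.

Lemma lmul_mono a a' b b' : a <= a' -> b <= b' -> a * b <= a' * b'.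
Proof.
move=> le_a le_b; apply: (le_trans (lmul_mono2l a le_b)).
by rewrite ![_ * b']lmulC; apply: lmul_mono2l.
Qed.

Lemma le_residual a b x : x * b <= a <-> x <= residual a b.
Proof.
split=> [|le_x]; first exact: le_bigjoin.
apply: (le_trans (lmul_mono le_x (lexx b))).
rewrite lmulC lmul_bigjoin; apply: bigjoin_le => _ [y le_yb <-].
by rewrite lmulC.
Qed.

Lemma residual_le2 p p' b : p <= p' -> residual p b <= residual p' b.
Proof.
by move=> le_p; apply/le_residual; apply: le_trans le_p; apply/le_residual.
Qed.

Lemma le_residual_self p b : p <= residual p b.
Proof.
by apply/le_residual; rewrite -[leRHS]lmul1x lmulC lmul_mono ?lex1.
Qed.

Lemma compact_join a b : compact_elt a -> compact_elt b ->
  compact_elt (a `|` b).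
Proof.
move=> ca cb X; rewrite leUx => /andP[/ca [s [sX le_a]] /cb [t [tX le_b]]].
exists (s ++ t); split=> [x|].
  by rewrite mem_cat => /orP[/sX|/tX].
by rewrite big_cat leU2.
Qed.

(** The order form of compact generation: it lets a bound on [a] be checked on
    compact elements, without naming a family of which [a] is the join. *)
Lemma compact_separation a p : compactly_generated L ->
  (forall c, compact_elt c -> c <= a -> c <= p) -> a <= p.
Proof.
move=> Lcg le_cp; have [X [cX aE]] := Lcg a.
rewrite aE; apply: bigjoin_le => x Xx; apply: le_cp (cX x Xx) _.
by rewrite aE; apply: le_bigjoin.
Qed.

Lemma compact_witness a p : compactly_generated L -> ~ (a <= p) ->
  exists c, [/\ compact_elt c, c <= a & ~ (c <= p)].
Proof.
move=> Lcg nle_ap; apply: contrapT => no_c; apply: nle_ap.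
apply: compact_separation => // c cc le_ca; apply: contrapT => nle_cp.
by apply: no_c; exists c.
Qed.

(** By the residual adjunction, a product that is not below [p] has a factor
    not below a residual of [p], so each factor in turn can be replaced by a
    compact one. *)
Lemma compact_mul_witness a b p : compactly_generated L -> ~ (a * b <= p) ->
  exists a' b', [/\ compact_elt a', compact_elt b',
    a' <= a, b' <= b & ~ (a' * b' <= p)].
Proof.
move=> Lcg nle_ab.
have [|a' [ca' le_a' nle_a']] := @compact_witness a (residual p b) Lcg.
  by move/le_residual.
have [|b' [cb' le_b' nle_b']] := @compact_witness b (residual p a') Lcg.
  by move/le_residual; rewrite lmulC => /le_residual.
exists a', b'; split=> //.
by rewrite lmulC => /le_residual.
Qed.

End MultLattice.

Theorem theorem2p9 (d : Order.disp_t) (L : multLatticeType d)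
  (Lcg : compactly_generated L)
  (top_compact : compact_elt (\top : L))
  (prod_compact : forall s : seq L,
    (forall x : L, x \in s -> compact_elt x) -> compact_elt (\prod_(x <- s) x))
  (delta : L -> L) (delta_expansion : expansion delta)
  (phi : L -> L) (phi_le : forall a : L, phi a <= a)
  (q : L) (q_proper : proper_elt q) :
  [<-> phi_delta_primary phi delta q;
       forall a : L, ~ (a <= delta q) ->
         residual q a = q \/ residual q a = residual (phi q) a;
       forall r s : L, compact_elt r -> compact_elt s ->
         r * s <= q -> ~ (r * s <= phi q) -> s <= q \/ r <= delta q].
Proof.
tfae.
- move=> [_ prim_q] a nle_a.
  have le_q : residual q a * a <= q by apply/le_residual.
  have [le_phi|nle_phi] := pselect (residual q a * a <= phi q).
    right; apply/le_anti/andP; split; first exact/le_residual.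
    exact: residual_le2.
  left; apply/le_anti; rewrite le_residual_self andbT.
  by case: (prim_q _ _ le_q nle_phi).
- move=> res_q r s _ _; rewrite lmulC => /le_residual le_s nle_phi.
  have [le_r|nle_r] := pselect (r <= delta q); [by right|left].
  have [<- //|resE] := res_q r nle_r.
  by case: nle_phi; apply/le_residual; rewrite -resE.
- move=> prim_q; split=> // a b le_ab nle_phi.
  have [le_b|nle_b] := pselect (b <= delta q); [by right|left].
  have [r [cr le_rb nle_r]] := compact_witness Lcg nle_b.
  have [a' [b' [ca' cb' le_a' le_b' nle_ab']]] :=
    compact_mul_witness Lcg nle_phi.
  apply: compact_separation => // s cs le_sa.
  have [|||||] := prim_q (r `|` b') (s `|` a').
  + exact: compact_join.
  + exact: compact_join.
  + by rewrite lmulC; apply: le_trans le_ab; rewrite lmul_mono // leUx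
      ?le_sa ?le_rb.
  + rewrite lmulC => le_phi; apply: nle_ab'; apply: le_trans le_phi.
    by rewrite lmul_mono ?leUr.
  + by rewrite leUx => /andP[].
  + by rewrite leUx => /andP[/nle_r].
Qed.
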